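(* Let $t \geq 4$ and $n \geq 1$ be integers, let $t' = [t/2]$, $x = \left[\frac{nt'-1}{t'-1}\right]$, and write $x-2 = tq + r$ with integers $q$ and $0 \leq r \leq t-1$. Let $R = R_{t-2,t}(K_{1,n})$. Then $R = x$ if and only if one of the following conditions holds: (a) $r = t-1$ and $x$ and $q+1$ are odd; (b) $r < t-2$ and $t \leq 2r+4$ and $t$ is even; (c) $r < t-2$ and $q+r+3 < t \leq 2q+2r+5$ and $t$ is odd.
   Context: $[a]$ denotes the integer part (floor) of a real number $a$. $K_{1,n}$ is the star with $n$ edges. For a graph $G$ and integers $1 \leq s < t$, $R_{s,t}(G)$ is the smallest positive integer $N$ such that every coloring of the edges of the complete graph $K_N$ with $t$ colors contains a (not necessarily induced) subgraph isomorphic to $G$ whose edges use at most $s$ distinct colors. *)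

(* Defs.v *)
From mathcomp Require Import all_boot all_order all_algebra.
Set Implicit Arguments. Unset Strict Implicit. Unset Printing Implicit Defensive.

(* A graph G is given by a finite vertex type V and an edge relation e
   (assumed symmetric/irreflexive where relevant).  A t-colouring of the
   edges of K_N is a function c assigning to the 2-set [set i; j] a colour
   in 'I_t (values on other subsets are irrelevant). *)

(* K_N coloured by c contains a copy of G whose edges use at most s colours:
   an injective vertex map f : V -> 'I_N (every pair of distinct vertices of
   K_N is an edge) such that the set of colours of the image edges has at
   most s elements. *)
Definition has_few_colour_copy (V : finType) (e : rel V) (s N t : nat)
  (c : {set 'I_N} -> 'I_t) : Prop :=
  exists f : V -> 'I_N, injective f /\
    #|[set c [set f u; f v] | u in V, v in V & e u v]| <= s.

Definition ramsey_prop (V : finType) (e : rel V) (s t N : nat) : Prop :=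
  forall c : {set 'I_N} -> 'I_t, has_few_colour_copy e s c.

Definition is_Rst (V : finType) (e : rel V) (s t N : nat) : Prop :=
  0 < N /\ ramsey_prop e s t N /\
  forall M, 0 < M -> M < N -> ~ ramsey_prop e s t M.

Definition star_rel (n : nat) : rel 'I_n.+1 :=
  fun i j => (i == ord0) != (j == ord0).

(* Main.v *)
Require Import Defs.
From mathcomp Require Import all_boot all_order all_algebra.
From mathcomp Require Import zify.
Import GRing.Theory Num.Theory.
Set Implicit Arguments. Unset Strict Implicit. Unset Printing Implicit Defensive.

(* A colouring of K_N has no K_{1,n} in at most t-2 colours iff at every vertex
   any two colour degrees have sum at least m := N - n.  The t colour degrees at
   a vertex add up to N - 1, which forces N - 1 >= t k if m = 2 k, with equality
   only if every colour class is k-regular (impossible when N and k are odd),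
   and N >= t (k + 1) if m = 2 k + 1.  Conversely, when these conditions hold,
   suitable colourings arise by distributing cyclically among the colours the
   factors of a 1-factorization (N even), of a decomposition into near-1-factors
   or of a decomposition into 2-factors (N odd).  With this criterion,
   R = x means that it fails for N = x and holds for N = x - 1; the rest is
   arithmetic, starting from t' m + 1 <= x <= t' (m + 1) - 1 for m = x - n. *)

(** * Stars in few colours in terms of colour degrees *)

Definition colour_nbhd N t (c : {set 'I_N} -> 'I_t) (v : 'I_N) (i : 'I_t) :=
  [set u | (u != v) && (c [set v; u] == i)].

Definition colour_deg N t (c : {set 'I_N} -> 'I_t) v i := #|colour_nbhd c v i|.

Lemma sum_colour_deg N t (c : {set 'I_N} -> 'I_t) v :
  \sum_i colour_deg c v i = N.-1.
Proof.
have -> : N.-1 = \sum_(u | u != v) 1 by rewrite sum1_card cardC1 card_ord.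
rewrite (partition_big (fun u => c [set v; u]) xpredT) //=.
by apply: eq_bigr => i _; rewrite sum1_card /colour_deg /colour_nbhd cardsE.
Qed.

Lemma colour_degD_other N t (c : {set 'I_N} -> 'I_t) v i j : i != j ->
  #|[set u | [&& u != v, c [set v; u] != i & c [set v; u] != j]]|
    + (colour_deg c v i + colour_deg c v j) = N.-1.
Proof.
move=> ij; have := cardC1 v; rewrite card_ord => <-.
have -> : colour_deg c v i + colour_deg c v j
          = #|colour_nbhd c v i :|: colour_nbhd c v j|.
  rewrite cardsU (_ : _ :&: _ = set0) ?cards0 ?subn0 //.
  apply/setP=> u; rewrite !inE.
  by case: (eqVneq (c _) i) => [-> |]; rewrite ?(negPf ij) ?andbF.
set A := [set u | _]; set B := _ :|: _.
have : A :&: B = set0.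
  apply/setP=> u; rewrite !inE.
  by case: (u != v); case: (_ == i); case: (_ == j).
have -> : #|predC1 v| = #|A :|: B|.
  apply: eq_card => u; rewrite !inE.
  by case: (u != v); case: (_ == i); case: (_ == j).
by rewrite cardsU => ->; rewrite cards0 subn0.
Qed.

(** A star in at most [t - 2] colours misses two colours [i] and [j], so at least [n] edges at its
    centre have other colours; conversely any [n] such edges form a star. *)
Lemma few_colour_starP N t n (c : {set 'I_N} -> 'I_t) : 2 <= t ->
  has_few_colour_copy (@star_rel n) (t - 2) c <->
  exists v i j, i != j /\ n + (colour_deg c v i + colour_deg c v j) < N.
Proof.
move=> t2; split.
- case=> f [f_inj]; set S := [set _ | _ in _, _ in _ & _] => cardS.
  have : 1 < #|~: S| by have := cardsC S; rewrite card_ord; lia.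
  case/card_gt1P=> i [j] [iS jS ij]; exists (f ord0), i, j; split=> //.
  have := colour_degD_other c (f ord0) ij; set A := [set u | _] => eqN.
  have nA : n <= #|A|.
    rewrite -[X in X <= _]card_ord -(card_imset _ (inj_comp f_inj (@lift_inj _ ord0))).
    apply/subset_leq_card/subsetP=> _ /imsetP[l _ ->]; rewrite inE /=.
    have cS : c [set f ord0; f (lift ord0 l)] \in S.
      by apply/imset2P; exists ord0 (lift ord0 l); rewrite // inE.
    apply/and3P; split.
    + by rewrite (inj_eq f_inj) eq_sym neq_lift.
    + by apply: contraTneq iS => <-; rewrite inE negbK.
    + by apply: contraTneq jS => <-; rewrite inE negbK.
  have := ltn_ord (f ord0); lia.
- case=> v [i] [j] [ij ltN].
  have := colour_degD_other c v ij; set A := [set u | _] => eqN.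
  have nA : n <= size (enum A) by rewrite -cardE; lia.
  pose f (l : 'I_n.+1) := nth v (v :: enum A) l.
  have fA l : l != ord0 -> f l \in A.
    case: l => [[|l] ltl] //= _; rewrite /f /= -mem_enum mem_nth //.
    exact: leq_trans nA.
  exists f; split.
    move=> l l' /eqP; rewrite /f nth_uniq /= ?ltnS.
    + by move/eqP/val_inj.
    + by apply: leq_trans nA; rewrite -ltnS.
    + by apply: leq_trans nA; rewrite -ltnS.
    + by rewrite enum_uniq mem_enum inE eqxx.
  have Aij u : u \in A -> c [set v; u] \in ~: [set i; j].
    by rewrite !inE => /and3P[_ /negPf-> /negPf->].
  have -> : t - 2 = #|~: [set i; j]|.
    by have := cardsC [set i; j]; rewrite card_ord cards2 ij; lia.
  apply/subset_leq_card/subsetP=> _ /imset2P[l l' _ + ->].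
  rewrite inE /star_rel /=; case: (eqVneq l ord0) => [-> | l0];
    case: (eqVneq l' ord0) => [-> | l'0] //= _.
  + exact/Aij/fA.
  + by rewrite setUC; exact/Aij/fA.
Qed.

Lemma ramsey_prop_widen (V : finType) (e : rel V) s t M N : M <= N ->
  ramsey_prop e s t M -> ramsey_prop e s t N.
Proof.
move=> MN rM c; have [f [f_inj cf]] := rM (fun A => c (widen_ord MN @: A)).
exists (widen_ord MN \o f); split.
  by apply: inj_comp f_inj => u v /(congr1 val) /= /val_inj.
apply: leq_trans cf; apply/subset_leq_card/subsetP=> _ /imset2P[u v uV vV ->].
apply/imset2P; exists u v => //; congr c.
by rewrite imsetU1 imset_set1.
Qed.

(** * Necessity of the criterion *)

(** With [d i0] minimal, every other [d i] is at least both [d i0] and [m - d i0]. *)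
Lemma sum_pairwise_ge t m (d : 'I_t -> nat) : 3 <= t ->
  (forall i j, i != j -> m <= d i + d j) ->
  if odd m then (t * m./2.+1 <= (\sum_i d i).+1 : Prop)
  else t * m./2 <= \sum_i d i /\
       (\sum_i d i = t * m./2 -> forall i, d i = m./2).
Proof.
move=> t3 dij; have t0 : 0 < t by lia.
case: (@arg_minnP _ (Ordinal t0) xpredT d isT) => i0 _ dmin.
have sumE : \sum_i d i = d i0 + \sum_(i | i != i0) d i by rewrite (bigD1 i0).
have geb b : (forall i, i != i0 -> b <= d i) -> b * t.-1 <= \sum_(i | i != i0) d i.
  move=> hb; apply: (@leq_trans (\sum_(i | i != i0) b)); last exact: leq_sum.
  by rewrite sum_nat_const cardC1 card_ord mulnC.
have g1 := geb (d i0) (fun i _ => dmin i isT).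
have g2 : (m - d i0) * t.-1 <= \sum_(i | i != i0) d i.
  by apply: geb => i ii0; have := dij _ _ ii0; lia.
have := odd_double_half m; set k := m./2.
case: (odd m) => mE.
  case: (leqP (d i0) k) => dk; nia.
case: (leqP k (d i0)) => dk; last by split; nia.
split; first nia.
move=> eqS i; apply/eqP; rewrite eqn_leq; apply/andP; split; last first.
  exact: leq_trans (dmin i isT).
(* If one value exceeded [k], the others, each at least [k], would push the sum above [t k]. *)
rewrite leqNgt; apply/negP => lti.
have : k * t.-1 <= \sum_(j | j != i) d j.
  have -> : k * t.-1 = \sum_(j | j != i) k.
    by rewrite sum_nat_const cardC1 card_ord mulnC.
  by apply: leq_sum => j _; exact: leq_trans (dmin j isT).
have : \sum_i d i = d i + \sum_(j | j != i) d j by rewrite (bigD1 i).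
nia.
Qed.

Lemma handshake N t (c : {set 'I_N} -> 'I_t) i :
  ~~ odd (\sum_v colour_deg c v i).
Proof.
(* [e] counts each edge of colour [i] once, at its smaller end. *)
pose e (v u : 'I_N) : nat := (v < u) && (c [set v; u] == i).
suff -> : \sum_v colour_deg c v i = (\sum_v \sum_u e v u).*2 by rewrite odd_double.
rewrite -addnn [X in _ = _ + X]exchange_big /= -big_split; apply: eq_bigr => v _ /=.
rewrite -big_split /= /colour_deg -sum1_card big_mkcond /=; apply: eq_bigr => u _.
rewrite inE /e [[set u; v]]setUC -val_eqE /=.
by case: ltngtP => _; case: eqP.
Qed.

(* Truncated subtraction makes this true for 0 < N <= n, as it should be. *)
Definition avoidable t n N :=
  let k := (N - n)./2 in
  if odd (N - n) then t * k.+1 <= N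
  else (t * k < N) && ~~ [&& N == (t * k).+1, odd N & odd k].

Lemma colouring_avoidable t n N (c : {set 'I_N} -> 'I_t) : 3 <= t -> 0 < N ->
  (forall v i j, i != j -> N <= n + (colour_deg c v i + colour_deg c v j)) ->
  avoidable t n N.
Proof.
move=> t3 N0 hc; rewrite /avoidable.
have dP v := @sum_pairwise_ge t (N - n) (colour_deg c v) t3.
have {}dP v : if odd (N - n) then (t * (N - n)./2.+1 <= N : Prop)
  else t * (N - n)./2 < N /\
       (N = (t * (N - n)./2).+1 -> forall i, colour_deg c v i = (N - n)./2).
  have := dP v; rewrite sum_colour_deg (prednK N0); case: (odd _) => H.
    by apply: H => i j ij; have := hc v _ _ ij; lia.
  have [i j ij|H1 H2] := H; first by have := hc v _ _ ij; lia.
  by split; [lia | move=> E i; apply: H2; rewrite {1}E].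
have := dP (Ordinal N0); case: (odd (N - n)) dP => // dP [lt_tk _].
(* Every colour class would be [k]-regular on [N] vertices with [N k] odd. *)
rewrite lt_tk; apply/and3P=> -[/eqP eqN oddN oddk].
have t0 : 0 < t by lia.
have := handshake c (Ordinal t0).
under eq_bigr => v _ do rewrite (dP v).2 //.
by rewrite sum_nat_const card_ord oddM oddN oddk.
Qed.

(** * Colourings with large colour degrees *)

Lemma pair_colouring N t (g : nat -> nat -> nat) : 0 < t ->
  (forall x y, g x y = g y x) ->
  exists c : {set 'I_N} -> 'I_t, forall u v, u != v -> c [set u; v] = g u v %% t :> nat.
Proof.
move=> t0 gC.
(* The order in which [enum] lists a pair is harmless as [g] is symmetric; 0 is a dummy value. *)
pose h (s : seq 'I_N) := if s is [:: x; y] then g x y else 0.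
exists (fun A : {set _} => Ordinal (ltn_pmod (h (enum A)) t0)) => u v uv /=; congr modn.
have : perm_eq (enum [set u; v]) [:: u; v].
  apply: uniq_perm; rewrite ?enum_uniq //= ?inE ?uv //.
  by move=> w; rewrite mem_enum !inE.
have := mem_enum [set u; v] u; have := mem_enum [set u; v] v.
have := enum_uniq [set u; v].
case: (enum _) => [|x [|y [|z s]]] //= xy + + /perm_size //=; rewrite !inE.
rewrite eqxx [v == u]eq_sym !eqxx orbT => /orP[] /eqP E1 /orP[] /eqP E2; subst => //.
  by rewrite eqxx in uv.
by rewrite eqxx in uv.
Qed.

(** The [k] numbers [t j + i] with [j < k] all lie below [L]. *)
Lemma card_residue_ge L t k i : i < t -> t * k + i < L + t ->
  k <= #|[set s : 'I_L | s %% t == i]|.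
Proof.
move=> it ltL; case: L ltL => [|L] ltL; first by case: k ltL => [|k] //; nia.
rewrite -[X in X <= _]card_ord.
pose f (j : 'I_k) : 'I_L.+1 := inord (t * j + i).
have fE j : f j = t * j + i :> nat by rewrite inordK //; have := ltn_ord j; nia.
have f_inj : injective f.
  by move=> j j' /(congr1 val); rewrite /= !fE => E; apply/val_inj => /=; nia.
rewrite -(card_imset _ f_inj); apply/subset_leq_card/subsetP => _ /imsetP[j _ ->].
by rewrite inE fE mulnC modnMDl modn_small.
Qed.

(** Being injective, [l] maps [A] onto all [L] labels, so degrees can be bounded by counting
    labels. *)
Lemma card_label_ge L N (A : {set 'I_N}) (l : 'I_N -> nat) (P : pred nat) :
    {in A &, injective l} -> {in A, forall u, l u < L} -> #|A| = L ->
  #|[set s : 'I_L | P s]| <= #|[set u in A | P (l u)]|.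
Proof.
case: L => [|L] l_inj lL cardA.
  by apply: leq_trans (max_card _) _; rewrite card_ord.
pose f u : 'I_L.+1 := inord (l u).
have fE u : u \in A -> f u = l u :> nat by move=> uA; rewrite inordK //; exact: lL.
have imA : f @: A = setT.
  apply/eqP; rewrite eqEcard subsetT cardsT card_ord card_in_imset ?cardA ?leqnn //.
  move=> u v uA vA /(congr1 val) /=; rewrite !fE //; exact: l_inj.
apply: leq_trans (leq_imset_card f _); apply/subset_leq_card/subsetP => s.
rewrite inE => Ps; have : s \in f @: A by rewrite imA inE.
by case/imsetP=> u uA sE; apply/imsetP; exists u; rewrite // inE uA -fE // -sE.
Qed.

Lemma modnD_lt N x y : x < N -> y < N ->
  (x + y) %% N = if x + y < N then x + y else x + y - N.
Proof.
move=> xN yN; case: ifP => xyN; first by rewrite modn_small.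
by rewrite -[in LHS](@subnK N (x + y)) ?modnDr ?modn_small //; lia.
Qed.

(* The classical 1-factorization of K_N for even N: vertices Z_(N-1) together
   with a point at infinity, edges labelled by the sum of their end points. *)
Lemma colouring_even N t : 0 < t -> 0 < N -> ~~ odd N ->
  exists c : {set 'I_N} -> 'I_t, forall v (i : 'I_t) k,
    t * k + i < N.-1 + t -> k <= colour_deg c v i.
Proof.
case: N => // p t0 _ evenN.
(* [p] is the point at infinity; its edge to [y] gets [2 y], the sum that [y] misses among the
   finite vertices. *)
pose l x y := if x == p then (y + y) %% p else
              if y == p then (x + x) %% p else (x + y) %% p.
have lC x y : l x y = l y x.
  by rewrite /l; do 2!case: eqVneq => [->|] //; rewrite addnC.
have [c cE] := @pair_colouring p.+1 t l t0 lC.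
exists c => v i k /(card_residue_ge (ltn_ord i)) /leq_trans; apply.
apply: leq_trans (@card_label_ge _ p.+1 [set~ v] (l v) (fun s => s %% t == i) _ _ _) _.
- move=> u w; rewrite !inE -!val_eqE /= /l.
  have := ltn_ord u; have := ltn_ord v; have := ltn_ord w.
  move=> wN vN uN uv wv eqL; apply/val_inj => /=; move: eqL.
  case: eqP => vp; [|case: eqP => up; case: eqP => wp]; rewrite ?modnD_lt; try do ?[case: ifP => ?]; lia.
- move=> u; rewrite !inE -val_eqE /= /l => uv.
  have p0 : 0 < p by have := ltn_ord u; have := ltn_ord v; lia.
  by case: ifP => _; [|case: ifP => _]; rewrite ltn_pmod.
- by rewrite cardsC1 card_ord.
apply/subset_leq_card/subsetP => u; rewrite !inE => /andP[uv lu].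
by rewrite uv -val_eqE /= cE // eq_sym.
Qed.

Lemma add_mod_inj N (v : 'I_N) : injective (fun u : 'I_N => (v + u) %% N).
Proof.
move=> u w /= eqL; apply/val_inj => /=; move: eqL; rewrite !modnD_lt //.
have := ltn_ord u; have := ltn_ord v; have := ltn_ord w; do 2!case: ifP => ?; lia.
Qed.

(* For odd N the labels x + y mod N form N near-1-factors, the vertex v being
   missed by the label 2 v only. *)
Lemma colouring_odd_sum N t : 0 < t ->
  exists c : {set 'I_N} -> 'I_t, forall v (i : 'I_t) k,
    t * k <= N -> k <= colour_deg c v i + ((v + v) %% N %% t == i).
Proof.
move=> t0; pose l x y := (x + y) %% N.
have [c cE] := @pair_colouring N t l t0 (fun x y => congr1 (modn^~ N) (addnC x y)).
exists c => v i k kN.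
have : t * k + i < N + t by have := ltn_ord i; lia.
move/(card_residue_ge (ltn_ord i)) => /leq_trans; apply.
have N0 : 0 < N by have := ltn_ord v; lia.
apply: leq_trans (@card_label_ge _ N setT (l v) (fun s => s %% t == i) _ _ _) _.
- by move=> u w _ _; exact: add_mod_inj.
- by move=> u _; rewrite ltn_pmod.
- by rewrite cardsT card_ord.
rewrite (cardsD1 v) addnC inE inE andTb leq_add2r.
apply/subset_leq_card/subsetP => u; rewrite !inE => /andP[uv lu].
by rewrite uv -val_eqE /= cE // eq_sym.
Qed.

(* Each cyclic distance is a 2-factor of K_N for odd N. *)
Lemma colouring_odd_diff N t k : 0 < t -> odd N -> t * k <= N./2 ->
  exists c : {set 'I_N} -> 'I_t, forall v (i : 'I_t), k.*2 <= colour_deg c v i.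
Proof.
move=> t0 oddN kN; pose dist x y := (x - y) + (y - x).
(* Cyclic distances start at 1, labels at 0. *)
pose g d := (minn d (N - d)).-1.
have [c cE] := @pair_colouring N t (fun x y => g (dist x y)) t0
  (fun x y => congr1 g (addnC (x - y) (y - x))).
exists c => v i; pose P e := (e != 0) && (g e %% t == i).
have N0 : 0 < N by have := ltn_ord v; lia.
have v'N : (N - v) %% N < N by rewrite ltn_pmod.
apply: (@leq_trans #|[set s : 'I_N | P s]|).
  rewrite -addnn -[X in X + X](card_ord k) -card_sum.
  (* The [2 k] differences [t j + i + 1] and their negatives mod [N] all have colour [i]. *)
  pose f (a : 'I_k + 'I_k) := match a with
    inl j => t * j + i.+1 | inr j => N - (t * j + i.+1) end.
  have bnd (j : 'I_k) : t * j + i.+1 <= N./2.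
    by have := ltn_ord j; have := ltn_ord i; nia.
  have NE := odd_double_half N; rewrite oddN in NE.
  have fN a : f a < N by case: a => j /=; have := bnd j; lia.
  have f_inj : injective (fun a => Ordinal (fN a)).
    move=> a b /(congr1 val) /=.
    case: a b => [j|j] [j'|j'] /=; have := bnd j; have := bnd j' => b1 b2 E;
     first [congr inl; apply/val_inj => /=; nia
           |congr inr; apply/val_inj => /=; nia | lia].
  rewrite -cardsT -(card_imset _ f_inj).
  apply/subset_leq_card/subsetP => _ /imsetP[a _ ->]; rewrite inE /P.
  have -> : g (Ordinal (fN a)) = (if a is inl j then j else if a is inr j then j else 0) * t + i.
    rewrite /g /=; case: a => j /=; have := bnd j; lia.
  rewrite modnMDl modn_small // eqxx andbT /=; case: a => j /=; have := bnd j; lia.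
apply: leq_trans (@card_label_ge _ N setT (fun u => (Ordinal v'N + u) %% N) P _ _ _) _.
- by move=> u u' _ _; exact: add_mod_inj.
- by move=> u _; rewrite ltn_pmod.
- by rewrite cardsT card_ord.
apply/subset_leq_card/subsetP => u; rewrite !inE /P /= => /andP[l0 lu].
have [uN vN] := (ltn_ord u, ltn_ord v).
have lE : ((N - v) %% N + u) %% N = if v <= u then u - v else N + u - v.
  case: (posnP v) => [-> | v0].
    by rewrite subn0 modnn add0n modn_small // subn0.
  by rewrite (@modn_small (N - v)) ?modnD_lt //; try do ?[case: ifP => ?]; lia.
have uv : u != v by apply: contraNneq l0 => uv; rewrite lE uv leqnn subnn.
rewrite uv -val_eqE /= cE 1?eq_sym //.
rewrite -(eqP lu) lE /g /dist; apply/eqP; congr (_ %% t).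
by case: ifP => ?; lia.
Qed.

(* The labels 0 and 1 form a Hamiltonian path 0, 1, -1, 2, -2, ... of Z_N.
   Colour the edge of this path that leads to v with the colour of the label
   2 v: this repairs the defect of v in the colouring by sums. *)
Lemma colouring_odd_repair N t k : 0 < t -> odd N -> t * k + 2 <= N ->
  exists c : {set 'I_N} -> 'I_t, forall v (i : 'I_t), k <= colour_deg c v i.
Proof.
move=> t0 oddN kN; pose l x y := (x + y) %% N.
(* The later end on the path: the larger one for label 0, the smaller one for label 1, except on the
   first edge, from 0 to 1. *)
pose head x y := if l x y == 0 then maxn x y else
                 if minn x y == 0 then maxn x y else minn x y.
(* The last vertex [N./2 + 1] of the path misses only label 1 and needs no repair; there the
   subtraction truncates to 0. *)
pose g x y := if 2 <= l x y then l x y - 2 else l (head x y) (head x y) - 2.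
have lC x y : l x y = l y x by rewrite /l addnC.
have gC x y : g x y = g y x by rewrite /g /head lC maxnC minnC.
have [c cE] := @pair_colouring N t g t0 gC.
exists c => v i; pose P s := (2 <= s) && ((s - 2) %% t == i).
have N0 : 0 < N by have := ltn_ord v; lia.
apply: (@leq_trans #|[set s : 'I_N | P s]|).
  have le_k : t * k + i < N - 2 + t by have := ltn_ord i; lia.
  apply: leq_trans (card_residue_ge (ltn_ord i) le_k) _.
  have sN (s : 'I_(N - 2)) : s + 2 < N by have := ltn_ord s; lia.
  have s_inj : injective (fun s => Ordinal (sN s)).
    by move=> s s' /(congr1 val) /= E; apply/val_inj => /=; lia.
  rewrite -(card_imset _ s_inj).
  apply/subset_leq_card/subsetP => _ /imsetP[s + ->]; rewrite !inE /P /=.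
  by rewrite addnK => ->; lia.
apply: leq_trans (@card_label_ge _ N setT (l v) P _ _ _) _.
- by move=> u w _ _; exact: add_mod_inj.
- by move=> u _; rewrite ltn_pmod.
- by rewrite cardsT card_ord.
pose prev := if v <= N./2 then (N.+1 - v) %% N else N - v.
have prevN : prev < N.
  by rewrite /prev; case: ifP => ?; rewrite ?ltn_pmod //; lia.
(* [v] itself, counted for label [2 v], is exchanged for its predecessor, which has label 0 or 1 and
   so is not counted yet. *)
pose f u := if u == v then Ordinal prevN else u.
have vN := ltn_ord v.
have NE := odd_double_half N; rewrite oddN in NE.
have prevE : 2 <= l v v ->
    (1 < v <= N./2 /\ prev = N.+1 - v) \/ (v = 1 :> nat /\ prev = 0)
    \/ (N./2 < v /\ prev = N - v).
  rewrite /l modnD_lt // => lv; rewrite /prev.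
  case: (ltngtP v 1) => [v0|v1|->]; first by move: lv; case: ifP => ?; lia.
    case: ifP => vh; last by right; right; split; lia.
    by left; split; rewrite ?modn_small //; lia.
  by right; left; rewrite subn1 /= modnn; case: ifP => //; lia.
clearbody prev.
have lprev : 2 <= l v v -> l v prev < 2 /\ (prev != v).
  move=> lv; have := prevE lv; move: lv; rewrite /l !modnD_lt //.
  by do 2!case: ifP => ?; move=> ? ?; split; lia.
have gprev : 2 <= l v v -> g v prev = l v v - 2.
  move=> lv; have [lp _] := lprev lv; rewrite /g leqNgt lp /=.
  suff -> : head v prev = v by [].
  have := prevE lv; move: lv lp; rewrite /head /l !modnD_lt //.
  by do ?[case: ifP => ?]; lia.
have f_inj : {in [set u : 'I_N in setT | P (l v u)] &, injective f}.
  move=> u w; rewrite !inE /= /f /P => /andP[lu _] /andP[lw _].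
  case: eqVneq => [uE|_]; case: eqVneq => [wE|_] // E; first by rewrite uE.
    rewrite uE in lu; have [] := lprev lu.
    by rewrite [prev](congr1 val E) ltnNge lw.
  rewrite wE in lw; have [] := lprev lw.
  by rewrite -[prev](congr1 val E) ltnNge lu.
rewrite -(card_in_imset f_inj).
apply/subset_leq_card/subsetP => _ /imsetP[u + ->]; rewrite !inE /= /P /f.
case/andP=> lu Plu; case: (eqVneq u v) => [uE|uv]; last first.
  by rewrite uv -val_eqE /= cE /g ?lu // eq_sym.
subst u; have [_ pv] := lprev lu.
have pv' : Ordinal prevN != v by rewrite -val_eqE.
by rewrite pv' -val_eqE /= cE ?gprev // eq_sym.
Qed.

(** * Sufficiency, and the criterion for the Ramsey number *)

Lemma avoidable_colouring t n N : 0 < t -> 0 < N -> avoidable t n N ->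
  exists c : {set 'I_N} -> 'I_t,
    forall v i j, i != j -> N <= n + (colour_deg c v i + colour_deg c v j).
Proof.
move=> t0 N0; rewrite /avoidable; have := odd_double_half (N - n).
set k := _./2; case: (odd (N - n)) => mE; last case/andP.
- move=> leN; case: (boolP (odd N)) => oddN.
    have [c cP] := @colouring_odd_sum N t t0.
    exists c => v i j ij; have := cP v i _ leN; have := cP v j _ leN.
    (* Only colour [a] can fall to [k] at [v], and [i], [j] are not both [a]. *)
    set a := _ %% t; have : ~~ ((a == i) && (a == j)).
      by apply: contra ij => /andP[/eqP ai /eqP aj]; rewrite -val_eqE /= -ai -aj.
    by do 2!case: (a == _) => //=; lia.
  have [c cP] := colouring_even t0 N0 oddN.
  exists c => v i j ij.
  (* With only [t (k + 1) - 1] factors guaranteed, the last colour may be one short. *)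
  have cP' (l : 'I_t) : k.+1 <= colour_deg c v l + (l.+1 == t).
    case: eqP => lt; last by have := cP v l k.+1; have := ltn_ord l; lia.
    by have := cP v l k; nia.
  have := cP' i; have := cP' j; move: ij; rewrite -val_eqE /=; lia.
- move=> ltN; case: (boolP (odd N)) => oddN /=; last first.
    move=> _; have [c cP] := colouring_even t0 N0 oddN.
    exists c => v i j _; have := cP v i k; have := cP v j k.
    have := ltn_ord i; have := ltn_ord j; lia.
  case: (boolP (odd k)) => oddk.
    rewrite andbT => neN; have [|c cP] := @colouring_odd_repair N t k t0 oddN.
      by lia.
    by exists c => v i j _; have := cP v i; have := cP v j; lia.
  move=> _; have [|c cP] := @colouring_odd_diff N t k./2 t0 oddN; first nia.
  by exists c => v i j _; have := cP v i; have := cP v j; lia.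
Qed.

Lemma ramsey_starE t n N : 3 <= t -> 0 < N ->
  ramsey_prop (@star_rel n) (t - 2) t N <-> ~~ avoidable t n N.
Proof.
move=> t3 N0; split=> [rN | nav c].
  apply/negP=> /avoidable_colouring[]//; first exact: leq_trans t3.
  move=> c cP; have [v [i [j [ij]]]] := (few_colour_starP n c (ltnW t3)).1 (rN c).
  by rewrite ltnNge cP.
apply/few_colour_starP; first exact: ltnW.
case: (boolP [exists v, exists i, exists j, (i != j) &&
              (n + (colour_deg c v i + colour_deg c v j) < N)]) => [|no].
  by case/existsP=> v /existsP[i] /existsP[j] /andP[ij lt]; exists v, i, j.
case/negP: nav; apply: (colouring_avoidable t3 N0 (c := c)) => v i j ij.
rewrite leqNgt; apply: contra no => lt.
by apply/existsP; exists v; apply/existsP; exists i; apply/existsP; exists j; rewrite ij.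
Qed.

Local Open Scope ring_scope.

(** By [ramsey_prop_widen], minimality need only be tested at [N - 1]. *)
Lemma is_Rst_star t n N : (3 <= t)%N -> (0 < n)%N -> (0 < N)%N ->
  is_Rst (@star_rel n) (t - 2) t N <-> ~~ avoidable t n N && avoidable t n N.-1.
Proof.
move=> t3 n0 N0; split.
  case=> _ [/(ramsey_starE n t3 N0) nav minN]; rewrite nav /=.
  have N1 : (1 < N)%N.
    rewrite ltnNge; apply: contra nav => N1; rewrite /avoidable.
    have -> : (N - n = 0)%N by lia.
    by rewrite muln0 N0 /= !andbF.
  have N'0 : (0 < N.-1)%N by lia.
  apply/negPn/negP => /(ramsey_starE n t3 N'0); apply: minN => //; lia.
case/andP=> nav av; split=> //; split; first exact/ramsey_starE.
move=> M M0 ltMN /(@ramsey_prop_widen _ _ _ _ _ N.-1) rN.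
have N'0 : (0 < N.-1)%N by lia.
have /(ramsey_starE n t3 N'0) : ramsey_prop (@star_rel n) (t - 2) t N.-1.
  by apply: rN; lia.
by rewrite av.
Qed.

(** * Arithmetic of [x] *)

Lemma lez_of_mul (t : nat) (a b : int) : (0 < t)%N -> t%:Z * a < t%:Z * (b + 1) -> a <= b.
Proof. by move=> t0; rewrite ltr_pM2l ?ltz_nat // => ?; lia. Qed.

Theorem theorem6 (t n : nat) (q r : int) :
  (4 <= t)%N -> (1 <= n)%N ->
  let t' := t./2 in
  let x := ((n * t' - 1) %/ (t' - 1))%N in
  (x%:Z - 2 = t%:Z * q + r) -> 0 <= r <= t%:Z - 1 ->
  (is_Rst (@star_rel n) (t - 2) t x <->
    [\/ (r = t%:Z - 1 /\ odd x /\ ~~ (2 %| q + 1)%Z),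
        (r < t%:Z - 2 /\ t%:Z <= 2 * r + 4 /\ ~~ odd t)
      | (r < t%:Z - 2 /\ q + r + 3 < t%:Z /\ t%:Z <= 2 * q + 2 * r + 5 /\ odd t)]).
Proof.
move=> t4 n1 t' x xE rE.
have t'2 : (2 <= t')%N by rewrite /t'; lia.
have tE := odd_double_half t; rewrite -/t' in tE.
have xl : (x * (t' - 1) <= n * t' - 1)%N by rewrite /x leq_divM.
have xu : (n * t' - 1 < x.+1 * (t' - 1))%N by rewrite /x ltn_ceil //; lia.
clearbody x t'.
have nx : (n <= x)%N by nia.
pose m := (x - n)%N; have xm : x = (m + n)%N by rewrite /m; lia.
(* With [n = x - m], the floor inequalities place [x] strictly between the multiples [t' m] and
   [t' (m + 1)]. *)
have bl : (t' * m + 1 <= x)%N by nia.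
have bu : (x + 1 <= t' * (m + 1))%N by nia.
have x0 : (0 < x)%N by lia.
apply: iff_trans (is_Rst_star _ n1 x0) _; first by lia.
rewrite /avoidable -/m.
have -> : (x.-1 - n = m.-1)%N by lia.
have mE := odd_double_half m; set k := m./2 in mE *.
clear xl xu xm nx n1; clearbody m k.
(* [q] may be -1, so [p = q + 1] replaces it; [r = t - 1] then means [x = t p + 1]. *)
have [p pE] : exists p : nat, q + 1 = p%:Z.
  exists (absz (q + 1)); suff : -1 <= q by lia.
  by apply: (@lez_of_mul t); lia.
have {pE}qE : q = p%:Z - 1 by lia.
subst q.
have oddE : x = (t * p).+1 -> odd x = ~~ (odd t && odd p).
  by move=> ->; rewrite /= oddM.
case: (boolP (odd m)) mE => oddm mE.
  have -> : odd m.-1 = false by lia.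
  have -> : (m.-1)./2 = k by lia.
  rewrite add1n in mE; subst m.
  case: (boolP (odd t)) tE => oddt tE.
    (* For odd [t], [t k + 1] and [k] are never both odd. *)
    have -> : [&& x.-1 == (t * k).+1, odd x.-1 & odd k] = false.
      apply/and3P=> -[/eqP x'E]; rewrite x'E /= oddM oddt /=.
      by case: (odd k).
    rewrite andbT; split.
      case/andP=> lt_x ltx.
      have pE : p%:Z = k%:Z + 1.
        have : p%:Z <= k%:Z + 1 by apply: (@lez_of_mul t); lia.
        have : k%:Z + 1 <= p%:Z by apply: (@lez_of_mul t); lia.
        lia.
      rewrite pE in xE *; subst t.
      by apply: Or33; split; [lia | split; [lia | split; [lia|]]].
    case=> [[rE' [oddx q1]] | [_ [_ //]] | [rlt [lo [hi _]]]].
      have xp : x = (t * p).+1 by lia.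
      by move: oddx (oddE xp) q1; lia.
    (* By (c), [x = 2 t' q + s] with [t' <= s = q + r + 2 < 2 t'], which forces [m = 2 q + 1]. *)
    have pE : p%:Z = k%:Z + 1.
      have : p%:Z <= k%:Z + 1 by apply: (@lez_of_mul t'); lia.
      have : k%:Z + 1 <= p%:Z by apply: (@lez_of_mul t'); lia.
      lia.
    by rewrite pE in xE; apply/andP; split; lia.
  (* For [t] even and [m] odd, both sides of the equivalence hold. *)
  have r_lo : (t * k + t' + 1 <= x)%N by subst t; lia.
  have r_hi : (x + 1 <= t * k + t)%N by subst t; lia.
  have pE : p%:Z = k%:Z + 1.
    have : p%:Z <= k%:Z + 1 by apply: (@lez_of_mul t); lia.
    have : k%:Z + 1 <= p%:Z by apply: (@lez_of_mul t); lia.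
    lia.
  rewrite pE in xE *; split=> _.
    by apply: Or32; split; [lia | split; [lia|]].
  apply/andP; split; first by lia.
  by apply/andP; split; [|apply/and3P=> -[/eqP x'E _ _]]; lia.
rewrite add0n in mE; subst m; split.
  case: (posnP k) => [-> | k0].
    by rewrite muln0 x0 /= !andbF.
  have -> : odd (k.*2).-1 by lia.
  have -> : ((k.*2).-1./2).+1 = k by lia.
  (* As [t k < x], only the parity exception can make [avoidable] fail at [x]. *)
  case/andP=> + tkx; have -> /= : (t * k < x)%N by lia.
  rewrite negbK => /and3P[/eqP xk oddx oddk].
  have pE : p = k.
    have : p%:Z <= k%:Z by apply: (@lez_of_mul t); lia.
    have : k%:Z <= p%:Z by apply: (@lez_of_mul t); lia.
    lia.
  by subst p; apply: Or31; split; [lia | split=> //; lia].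
case=> [[rE' [oddx q1]] | [rlt [lo evt]] | [rlt [lo [hi oddt]]]].
- have xp : x = (t * p).+1 by lia.
  have oddp : odd p by lia.
  have evt : odd t = false by move: (oddE xp); rewrite oddx oddp; lia.
  rewrite evt add0n in tE; subst t.
  have pE : p = k.
    have : p%:Z <= k%:Z by apply: (@lez_of_mul t'.*2); lia.
    have : k%:Z <= p%:Z by apply: (@lez_of_mul t'.*2); lia.
    lia.
  subst p; have k0 : (0 < k)%N by case: (k) oddp.
  have -> : odd (k.*2).-1 by lia.
  have -> : ((k.*2).-1./2).+1 = k by lia.
  by rewrite -xp eqxx oddx oddp andbF xp /=; lia.
(* Both (b) and (c) give [2 t' q + t' <= x < 2 t' (q + 1)], while [m = 2 k] puts [x] strictly
   between [2 t' k] and [2 t' k + t']. *)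
- rewrite (negPf evt) add0n in tE; subst t.
  have : p%:Z <= k%:Z by apply: (@lez_of_mul t'.*2); lia.
  have : k%:Z <= p%:Z - 1 by apply: (@lez_of_mul t'.*2); lia.
  lia.
- rewrite oddt add1n in tE; subst t.
  have : p%:Z <= k%:Z by apply: (@lez_of_mul t'); lia.
  have : k%:Z <= p%:Z - 1 by apply: (@lez_of_mul t'); lia.
  lia.
Qed.
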